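(* For any error measure $k \in \{k_{\#}, k_M, k_h\}$, every deterministic algorithm for the minimum, sorting, or MST problem under uncertainty has competitive ratio $\rho\geq \min\{1+\frac{k}{\mathrm{opt}},2\}$; that is, no deterministic algorithm guarantees $|\mathrm{ALG}| < \min\{1+\frac{k}{\mathrm{opt}},2\}\cdot \mathrm{opt}$ on all instances. This holds even for the minimum and sorting problems with pairwise disjoint sets.
   Context: Each uncertain element $i$ has an interval $I_i$ that is open $(L_i,U_i)$ or trivial $\{w_i\}$, an unknown true value $w_i\in I_i$ (revealed by a query) and a predicted value $\bar w_i\in I_i$. Minimum problem: given intervals and a family $\mathcal{S}$ of subsets, determine for each set an element of minimum true value. Sorting problem: determine for each set the order by true value. MST problem: graph with an interval per edge weight; determine a spanning tree that is an MST for the true weights. A query set is feasible if the answer is the same for all value assignments in the intervals agreeing with the true values on it; $\mathrm{opt}$ is the minimum size of a feasible query set, and $|\mathrm{ALG}|$ is the number of queries of an adaptive algorithm that stops once its queries are feasible. Error measures: $k_{\#}=|\{i: w_i\ne\bar w_i\}|$; $k_M=|\mathcal{I}_P\triangle\mathcal{I}_R|$ where $\mathcal{I}_R$ is the set of elements in every feasible query set and $\mathcal{I}_P$ the set of elements in every feasible query set when true values are assumed to equal the predictions; $k_h$ is the hop distance: for non-trivial $I_j=(L_j,U_j)$, the value of $I_i$ passes over $L_j$ if one of $w_i,\bar w_i$ is $\le L_j$ and the other $>L_j$, and over $U_j$ if one is $<U_j$ and the other $\ge U_j$; for trivial $I_j=\{w_j\}$ it jumps over $I_j$ if one of $w_i,\bar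 w_i$ is $<w_j$ and the other $>w_j$; with $A_i$ the union of the sets containing $I_i$ (minimum/sorting) or the edges on cycles containing edge $i$ (MST), $h_i$ counts the passes over endpoints of non-trivial intervals in $A_i$ plus jumps over trivial intervals in $A_i$, and $k_h=\sum_i h_i$. *)

(* Defs.v *)
From HB Require Import structures.
From mathcomp Require Import all_boot all_order all_algebra.
From mathcomp Require Import boolp reals.

Set Implicit Arguments.
Unset Strict Implicit.
Unset Printing Implicit Defensive.

Import Order.TTheory GRing.Theory Num.Theory.
Local Open Scope ring_scope.

Inductive uinterval (R : realType) : Type :=
  | OpenI of R & R
  | TrivialI of R.

Definition in_uinterval (R : realType) (J : uinterval R) (x : R) : bool :=
  match J with
  | OpenI l u => l < x < u
  | TrivialI v => x == v
  end.

(* A graph with edge set [E]: an edge is mapped to its set of end points. *)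
Record graph (E : finType) : Type := Graph {
  vertex : finType;
  ends : E -> {set vertex}
}.

Section Graph.
Variables (E : finType) (G : graph E).

Definition simple_graph : Prop :=
  injective (@ends E G) /\ forall e, #|ends G e| = 2.

Definition adj (F : {set E}) : rel (vertex G) :=
  fun x y => [exists e in F, ends G e == [set x; y]].

Definition connected_by (F : {set E}) : Prop :=
  forall x y : vertex G, connect (adj F) x y.

Definition cycle_edges (c : seq (vertex G)) : {set E} :=
  [set e | [exists x in c, ends G e == [set x; next c x]]].

Definition is_cycle (C : {set E}) : Prop :=
  exists c : seq (vertex G),
    [/\ (2 < size c)%N, ucycle (adj [set: E]) c & C = cycle_edges c].

Definition spanning_tree (T : {set E}) : Prop :=
  connected_by T /\ forall C : {set E}, is_cycle C -> ~~ (C \subset T).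

Definition is_mst (R : realType) (w : E -> R) (T : {set E}) : Prop :=
  spanning_tree T /\
  forall T' : {set E}, spanning_tree T' ->
    \sum_(e in T) w e <= \sum_(e in T') w e.

End Graph.

Inductive problem : Set := Minimum | Sorting | MST.

Definition structure (p : problem) (E : finType) : Type :=
  match p with
  | Minimum | Sorting => {set {set E}}
  | MST => graph E
  end.

Definition valid_structure (p : problem) (E : finType) :
    structure p E -> Prop :=
  match p return structure p E -> Prop with
  | Minimum | Sorting => fun F => set0 \notin F
  | MST => fun G => simple_graph G /\ connected_by G [set: E]
  end.

Definition disjoint_sets (p : problem) (E : finType) : structure p E -> Prop :=
  match p return structure p E -> Prop with
  | Minimum | Sorting => fun F => trivIset F
  | MST => fun _ => True
  end.

Definition answer (p : problem) (E : finType) : Type :=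
  match p with
  | Minimum => {set E} -> option E
  | Sorting => {set E} -> seq E
  | MST => {set E}
  end.

Definition correct_answer (R : realType) (p : problem) (E : finType) :
    structure p E -> (E -> R) -> answer p E -> Prop :=
  match p return structure p E -> (E -> R) -> answer p E -> Prop with
  | Minimum => fun F w a => forall S : {set E}, S \in F ->
      exists i : E,
        [/\ a S = Some i, i \in S & forall j : E, j \in S -> w i <= w j]
  | Sorting => fun F w a => forall S : {set E}, S \in F ->
      perm_eq (a S) (enum S) /\ sorted (fun i j => w i <= w j) (a S)
  | MST => fun G w a => is_mst G w a
  end.

(* The set $A_i$ over which the hop distance of [i] is counted. *)
Definition related (p : problem) (E : finType) :
    structure p E -> E -> {set E} :=
  match p return structure p E -> E -> {set E} with
  | Minimum | Sorting => fun F i => \bigcup_(S in F | i \in S) S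
  | MST => fun G i =>
      [set j | `[< exists C, [/\ is_cycle G C, i \in C & j \in C] >]]
  end.

(* Everything an algorithm knows before its first query. *)
Record input (R : realType) (p : problem) (E : finType) : Type := Input {
  struct : structure p E;
  ival : E -> uinterval R;
  predicted : E -> R
}.

Section Instance.
Variables (R : realType) (p : problem) (E : finType).
Variables (x : input R p E) (w : E -> R).

Definition valid_instance : Prop :=
  [/\ valid_structure (struct x),
      forall i, in_uinterval (ival x i) (w i) &
      forall i, in_uinterval (ival x i) (predicted x i)].

Definition feasible (Q : {set E}) : Prop :=
  exists a : answer p E, forall w' : E -> R,
    (forall i, in_uinterval (ival x i) (w' i)) ->
    (forall i, i \in Q -> w' i = w i) ->
    correct_answer (struct x) w' a.

(* On valid instances [setT] is feasible, so the arg min is meaningful. *)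
Definition opt : nat :=
  #|[arg min_(Q < [set: E] | `[< feasible Q >]) #|Q| ]%N|.

Definition mandatory : {set E} :=
  [set i | `[< forall Q : {set E}, feasible Q -> i \in Q >]].

End Instance.

Definition hops (R : realType) (v v' : R) (J : uinterval R) : nat :=
  match J with
  | OpenI l u =>
      addn ((v <= l < v') || (v' <= l < v)) ((v < u <= v') || (v' < u <= v))
  | TrivialI c => (v < c < v') || (v' < c < v)
  end.

Inductive error_measure : Set := KSharp | KM | KH.

Definition error (m : error_measure) (R : realType) (p : problem)
    (E : finType) (x : input R p E) (w : E -> R) : nat :=
  match m with
  | KSharp => #|[set i | w i != predicted x i]|
  | KM => let IP := mandatory x (predicted x) in
          let IR := mandatory x w in
          #|(IP :\: IR) :|: (IR :\: IP)|
  | KH => (\sum_(i : E) \sum_(j in related (struct x) i)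
            hops (w i) (predicted x i) (ival x j))%N
  end.

(* A deterministic adaptive algorithm maps its input and the list of queried *)
(* elements with their revealed values to the next query; [None] is halting. *)
Definition algorithm (R : realType) (p : problem) : Type :=
  forall E : finType, input R p E -> seq (E * R) -> option E.

Section Run.
Variables (R : realType) (p : problem) (A : algorithm R p) (E : finType).
Variables (x : input R p E) (w : E -> R).

Fixpoint history (t : nat) : seq (E * R) :=
  if t is t'.+1 then
    let h := history t' in
    if A x h is Some i then rcons h (i, w i) else h
  else [::].

(* [A] halts after exactly [t] queries, and the set it queried is feasible; *)
(* the size condition says that [A] has not halted before.                  *)
Definition solves_with (t : nat) : Prop :=
  [/\ A x (history t) = None,
      size (history t) = t &
      feasible x w [set i in unzip1 (history t)]].

End Run.

(* Correctness is only asked for on pairwise disjoint set families, so that  *)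
(* algorithms for this special case are covered too (no restriction for MST).*)
Definition algorithm_for_disjoint (R : realType) (p : problem)
    (A : algorithm R p) : Prop :=
  forall (E : finType) (x : input R p E) (w : E -> R),
    valid_instance x w -> disjoint_sets (struct x) ->
    exists t : nat, solves_with A x w t.

(* Main.v *)
Require Import Defs.
From HB Require Import structures.
From mathcomp Require Import all_boot all_order all_algebra.
From mathcomp Require Import boolp reals.
From mathcomp Require Import lra.

Set Implicit Arguments.
Unset Strict Implicit.
Unset Printing Implicit Defensive.

Import Order.TTheory GRing.Theory Num.Theory.
Local Open Scope ring_scope.

(** The instance consists of [o] couples of overlapping open intervals, each a
    set of its own (minimum, sorting) or two edges of a triangle whose third
    edge is cheap, all triangles sharing one vertex (MST). A couple is ordered
    by one query exactly when that query reveals a value outside the overlap.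
    In [min(k, o)] couples both predictions lie in the overlap; the adversary
    keeps the prediction for the element that is queried first and moves the
    value of the other one out of the overlap. The algorithm then queries both
    elements although the second one suffices, and this costs one unit of every
    error measure. In the remaining couples the predictions are correct and one
    query is necessary and sufficient. *)

(** * Auxiliary facts on finite sums, pairs and cyclic sequences *)

Lemma big_option_bool (V : Type) (idx : V) (op : Monoid.com_law idx)
    (F : option bool -> V) :
  \big[op/idx]_c F c = op (F None) (op (F (Some true)) (F (Some false))).
Proof.
rewrite (bigD1 None) //= (bigD1 (Some true)) //= (bigD1 (Some false)) //=.
by rewrite big1 ?Monoid.mulm1 // => -[[]|].
Qed.

Lemma set2_eqP (T : finType) (a b x y : T) :
  reflect ((x = a /\ y = b) \/ (x = b /\ y = a)) ([set a; b] == [set x; y]).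
Proof.
apply: (iffP eqP) => [/setP eqab|[[-> ->]|[-> ->]] //]; last by rewrite setUC.
have := eqab a; have := eqab b; have := eqab x; have := eqab y.
rewrite !inE !eqxx /= ?orbT /=.
move=> /orP[]/eqP -> /orP[]/eqP ->; rewrite ?eqxx ?orbT ?orbb; try by auto.
- by move=> /esym/eqP ->; auto.
- by move=> _ /esym/eqP ->; auto.
Qed.

(** After rotating [x] to the front, its neighbours are the second and the last entry, which differ
    in a duplicate-free list of length at least 3. *)
Lemma next_neq_prev (T : eqType) (c : seq T) (x : T) :
  uniq c -> (2 < size c)%N -> x \in c -> next c x != prev c x.
Proof.
move=> uc sc /rot_to[i s ec].
rewrite -(next_rot i uc) -(prev_rot i uc) ec.
have := uc; rewrite -(rot_uniq i) ec; move: sc; rewrite -(size_rot i) ec.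
case: s {ec} => [|y [|z s]] // _; rewrite !cons_uniq => /and3P[].
rewrite !inE !negb_or => /and3P[xy xz xs] ynz _.
have -> : next [:: x, y, z & s] x = y by rewrite /= eqxx.
have -> : prev [:: x, y, z & s] x = last z s.
  rewrite /= (negPf xy) (negPf xz).
  elim: s z xs {xz ynz} => [|t s IH] z /=; first by rewrite ?eqxx.
  by rewrite inE negb_or => /andP[/negPf -> /IH].
by apply: contraTneq ynz => ->; rewrite -negb_or -in_cons mem_last.
Qed.

(** * Cycles, spanning trees and minimum spanning trees of the windmill graph *)

Section Windmill.
Variable n : nat.

Definition elt : finType := ('I_n * option bool)%type.

(** The hub is the vertex [None]. Triangle [g] has two spokes [(g, Some b)] from the hub to
    [Some (g, b)] and the rim edge [(g, None)]. *)
Definition windmill : graph elt :=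
  @Graph elt (option ('I_n * bool)) (fun e =>
    if e.2 is Some b then [set None; Some (e.1, b)]
    else [set Some (e.1, false); Some (e.1, true)]).

Lemma adj_windmill (F : {set elt}) (x y : vertex windmill) :
  @adj _ windmill F x y =
  match x, y with
  | None, Some (g, b) | Some (g, b), None => (g, Some b) \in F
  | Some (g, b), Some (g', b') => [&& g == g', b != b' & (g, None) \in F]
  | None, None => false
  end.
Proof.
apply/exists_inP/idP => [[[g [b|]] eF /set2_eqP /=]|].
- by case=> [] [-> ->].
- by case=> [] [-> ->]; rewrite eqxx.
case: x y => [[g b]|] [[g' b']|] //=.
- move=> /and3P[/eqP <- nb gF]; exists (g, None) => //; apply/set2_eqP.
  by case: b b' nb => [] [] //; auto.
- by move=> gF; exists (g, Some b) => //; apply/set2_eqP; auto.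
- by move=> gF; exists (g', Some b') => //; apply/set2_eqP; auto.
Qed.

Lemma adj_windmill_sym (F : {set elt}) : symmetric (@adj _ windmill F).
Proof.
move=> [[g b]|] [[g' b']|]; rewrite !adj_windmill // eq_sym (eq_sym b).
by case: eqP => [->|].
Qed.

Lemma windmill_simple : simple_graph windmill.
Proof.
split=> [[g [b|]] [g' [b'|]] /= /eqP /set2_eqP|[g [b|]] /=].
- by case=> [[_ [-> ->]]|[]].
- by case=> [[]|[]].
- by case=> [[]|[]].
- by case=> [[[->]]|[]].
- by rewrite cards2.
- by rewrite cards2; case: eqP => // -[].
Qed.

(** An outer vertex has only two neighbours, the hub and the other outer vertex of its triangle, so
    a cycle through it runs around that triangle. The hub is visited once, hence no second triangle
    is met. *)
Lemma cycle_windmill (C : {set elt}) :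
  is_cycle windmill C -> exists g, C = [set e | e.1 == g].
Proof.
case=> c [sc /andP[cc uc] ->].
have nextV (x : vertex windmill) : x \in c -> @adj _ windmill setT x (next c x).
  exact: next_cycle.
have nbr g b : Some (g, b) \in c ->
    (next c (Some (g, b)) = None /\ prev c (Some (g, b)) = Some (g, ~~ b)) \/
    (next c (Some (g, b)) = Some (g, ~~ b) /\ prev c (Some (g, b)) = None).
  move=> vc; have := nextV _ vc; have := prev_cycle cc vc.
  have := next_neq_prev uc sc vc; rewrite !adj_windmill.
  case: next => [[g1 b1]|]; case: prev => [[g2 b2]|] //=.
  - move=> ne /and3P[/eqP g2g nb2 _] /and3P[/eqP gg1 nb1 _]; move: ne.
    by rewrite g2g -gg1; case: b b1 b2 nb1 nb2 {vc} => [] [] []; rewrite ?eqxx.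
  - by move=> _ _ /and3P[/eqP <- nb _]; right; case: b b1 nb {vc} => [] [].
  - by move=> _ /and3P[/eqP -> nb _] _; left; case: b b2 nb {vc} => [] [].
(* The cycle goes from the hub to an outer vertex, to its partner and back to the hub; [b'] marks
   the outer vertex met first. *)
have tri g b : Some (g, b) \in c -> exists b', [/\ None \in c,
    next c None = Some (g, b'), Some (g, b') \in c & [/\
    next c (Some (g, b')) = Some (g, ~~ b'), Some (g, ~~ b') \in c &
    next c (Some (g, ~~ b')) = None]].
  move=> vc; case: (nbr _ _ vc) => [] [nv pv].
  - have vc' : Some (g, ~~ b) \in c by rewrite -pv mem_prev.
    have nv' : next c (Some (g, ~~ b)) = Some (g, b) by rewrite -pv next_prev.
    have [[]|[_ pv']] := nbr _ _ vc'; first by rewrite nv'.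
    exists (~~ b); rewrite negbK; split=> //; first by rewrite -nv mem_next.
    by rewrite -pv' next_prev.
  - have vc' : Some (g, ~~ b) \in c by rewrite -nv mem_next.
    have pv' : prev c (Some (g, ~~ b)) = Some (g, b) by rewrite -nv prev_next.
    have [[nv' _]|[]] := nbr _ _ vc'; last by rewrite pv'.
    exists b; split=> //; first by rewrite -pv mem_prev.
    by rewrite -pv next_prev.
have [g [b vc]] : exists g b, Some (g, b) \in c.
  case: c sc uc {cc nextV nbr tri} => [|[[g b]|] [|[[g' b']|] c]] //= _ _.
  - by exists g, b; rewrite inE eqxx.
  - by exists g, b; rewrite inE eqxx.
  - by exists g', b'; rewrite !inE eqxx.
have [b' [Nc nN vc1 [n1 vc2 n2]]] := tri _ _ vc.
exists g; apply/setP => -[g' d]; rewrite !inE /=; apply/exists_inP/eqP.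
  case=> -[[g1 b1]|] xc.
  (* The hub has one successor, so every outer vertex on the cycle belongs to triangle [g]. *)
  - have [b2 [_ nN' _ _]] := tri _ _ xc; move: nN'; rewrite nN => -[-> _].
    by case: d => [d|] /set2_eqP[[]|[]] // [].
  - by rewrite nN; case: d => [d|] /set2_eqP[[]|[]] // _ [].
move=> ->; case: d => [d|] /=; last first.
  exists (Some (g, b')) => //; apply/set2_eqP; rewrite n1.
  by case: (b'); auto.
have [->|nd] := eqVneq d b'.
  by exists None => //; apply/set2_eqP; rewrite nN; auto.
have -> : d = ~~ b' by case: d b' nd {nN vc1 n1 vc2 n2} => [] [].
by exists (Some (g, ~~ b')) => //; apply/set2_eqP; rewrite n2; auto.
Qed.

Lemma triangle_cycle (g : 'I_n) : is_cycle windmill [set e | e.1 == g].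
Proof.
pose c : seq (vertex windmill) := [:: None; Some (g, false); Some (g, true)].
have cyc : is_cycle windmill (@cycle_edges _ windmill c).
  exists c; split=> //; apply/andP; split.
    by rewrite /= !adj_windmill !inE eqxx.
  by rewrite /= !inE; case: eqP => // -[].
have [g' eg'] := cycle_windmill cyc.
suff <- : g' = g by rewrite -eg'.
have : (g, Some false) \in @cycle_edges _ windmill c.
  by rewrite inE; apply/exists_inP; exists None; rewrite ?inE.
by rewrite eg' inE /= => /eqP.
Qed.

(** Acyclicity forbids all three edges of a triangle, and connectivity demands at least two. Hence
    the triangles can be treated independently. *)
Lemma spanning_tree_windmill (T : {set elt}) :
  spanning_tree windmill T <->
  forall g, (((g, None) \in T) + (((g, Some true) \in T) +
             ((g, Some false) \in T)) = 2)%N.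
Proof.
split=> [[conT acT] g|T2].
  have : ~~ [&& (g, None) \in T, (g, Some true) \in T & (g, Some false) \in T].
    apply: contra (acT _ (triangle_cycle g)) => /and3P[T1 T2 T3].
    by apply/subsetP => -[g' d]; rewrite inE /= => /eqP ->; case: d => [[]|].
  (* Without both edges at an outer vertex, that vertex alone would be closed under adjacency. *)
  have leaf b : ((g, None) \in T) || ((g, Some b) \in T).
    have := conT (Some (g, b)) None; apply: contraTT; rewrite negb_or.
    move=> /andP[/negPf nN /negPf nb]; apply/negP.
    move=> /(@closed_connect _ _ (pred1 (Some (g, b)))).
    rewrite !inE eqxx => clN.
    suff : true = false by []; apply: clN.
    move=> [[g1 b1]|] [[g2 b2]|]; rewrite adj_windmill ?inE //.
    - move=> /and3P[/eqP <- _ gT]; rewrite !(inj_eq (@Some_inj _)) !xpair_eqE.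
      by case: eqP gT => // ->; rewrite nN.
    - by apply: contraTF => /eqP[-> ->]; rewrite nb.
    - by move=> gT; apply/esym; apply: contraTF gT => /eqP[-> ->]; rewrite nb.
  (* The same cut argument, now for the two outer vertices of triangle [g] together. *)
  have : ((g, Some true) \in T) || ((g, Some false) \in T).
    have := conT (Some (g, true)) None; apply: contraTT; rewrite negb_or.
    move=> /andP[/negPf nt /negPf nf]; apply/negP.
    pose a := [pred x : vertex windmill |
      if x is Some v then v.1 == g else false].
    move=> /(@closed_connect _ _ a); rewrite !inE eqxx => clN.
    suff : true = false by []; apply: clN.
    move=> [[g1 b1]|] [[g2 b2]|]; rewrite adj_windmill ?inE //=.
    - by move=> /and3P[/eqP <-].
    - by apply: contraTF => /eqP ->; case: b1; rewrite ?nt ?nf.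
    - move=> gT; apply/esym; apply: contraTF gT => /eqP ->.
      by case: b2; rewrite ?nt ?nf.
  by have := leaf true; have := leaf false; do 3!case: (_ \in T).
split.
  have conN g b : connect (@adj _ windmill T) None (Some (g, b)).
    have [gb|gb] := boolP ((g, Some b) \in T).
      by apply: connect1; rewrite adj_windmill.
    apply: (@connect_trans _ _ (Some (g, ~~ b))); apply: connect1;
      rewrite adj_windmill ?eqxx; have := T2 g;
      by move: gb; case: (b); do 3!case: (_ \in T).
  have csym := sym_connect_sym (adj_windmill_sym T).
  have conV v : connect (@adj _ windmill T) None v by case: v => [[]|].
  by move=> x y; apply: connect_trans (conV y); rewrite csym.
move=> C /cycle_windmill[g ->]; apply/negP => /subsetP sub; have := T2 g.
by rewrite !sub ?inE.
Qed.

Lemma sum_windmill (R : realType) (w : elt -> R) (T : {set elt}) :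
  \sum_(e in T) w e =
  \sum_(g < n) \sum_c (if (g, c) \in T then w (g, c) else 0).
Proof. by rewrite big_mkcond pair_big; apply: eq_bigr => -[]. Qed.

(** Replacing the tree edges of one triangle by any other two of its edges gives a spanning tree
    again, and the other triangles cancel in the comparison of weights. *)
Lemma mst_windmill_swap (R : realType) (w : elt -> R) (T : {set elt})
    (g : 'I_n) (D : pred (option bool)) :
  is_mst windmill w T -> (D None + (D (Some true) + D (Some false)) = 2)%N ->
  \sum_c (if (g, c) \in T then w (g, c) else 0) <=
  \sum_c (if D c then w (g, c) else 0).
Proof.
move=> [/spanning_tree_windmill T2 minT] D2.
pose T' : {set elt} := [set e | if e.1 == g then D e.2 else e \in T].
have /minT : spanning_tree windmill T'.
  by apply/spanning_tree_windmill => h; rewrite !inE /=; case: eqP.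
rewrite !sum_windmill (bigD1 g) //= [leRHS](bigD1 g) //=.
rewrite [X in _ <= _ + X](eq_bigr (fun h =>
    \sum_c (if (h, c) \in T then w (h, c) else 0))); last first.
  by move=> h /negPf gh; apply: eq_bigr => c _; rewrite inE /= gh.
by rewrite lerD2r; under [leRHS]eq_bigr => c _ do rewrite inE /= eqxx.
Qed.

End Windmill.

(** * Couples of overlapping intervals and their relation to answers *)

Section Gadget.
Variables (R : realType) (n : nat).

(** For MST these are the two spokes of triangle [g]. The element [(g, None)] is the rim edge there
    and lies in no set of the other two problems. *)
Definition couple (g : 'I_n) : {set elt n} :=
  [set (g, Some false); (g, Some true)].

Definition gadget (p : problem) : structure p (elt n) :=
  match p with
  | Minimum | Sorting => [set couple g | g : 'I_n]
  | MST => windmill n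
  end.

(* The two intervals of a couple overlap in $(4, 8)$. *)
Definition gadget_ival (i : elt n) : uinterval R :=
  match i.2 with
  | None => TrivialI 0
  | Some false => OpenI 2 8
  | Some true => OpenI 4 10
  end.

Definition consistent (w : elt n -> R) : Prop :=
  forall i, in_uinterval (gadget_ival i) (w i).

Lemma mem_couple (g : 'I_n) (i : elt n) :
  reflect (exists b, i = (g, Some b)) (i \in couple g).
Proof.
rewrite !inE; apply: (iffP orP) => [[/eqP ->|/eqP ->]|[[] ->]].
- by exists false.
- by exists true.
- by right.
- by left.
Qed.

Lemma gadget_valid (p : problem) : valid_structure (gadget p).
Proof.
have ne : set0 \notin [set couple g | g : 'I_n].
  apply/imsetP => -[g _ /setP/(_ (g, Some true))].
  by rewrite !inE eqxx orbT.
case: p => //=; split; first exact: windmill_simple.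
(* Connectivity is inherited from the spanning tree of all rim edges and one spoke per triangle. *)
suff /spanning_tree_windmill[] : forall g : 'I_n,
    (((g, None) \in [set i : elt n | i.2 != Some true]) +
    (((g, Some true) \in [set i : elt n | i.2 != Some true]) +
    ((g, Some false) \in [set i : elt n | i.2 != Some true])) = 2)%N.
  move=> conn _ x y; apply: connect_sub (conn x y) => u v.
  move=> /exists_inP[e _ uv]; apply: connect1; apply/exists_inP.
  by exists e.
by move=> g; rewrite !inE.
Qed.

Lemma gadget_disjoint (p : problem) : disjoint_sets (gadget p).
Proof.
have tI : trivIset [set couple g | g : 'I_n].
  apply/trivIsetP => _ _ /imsetP[g _ ->] /imsetP[h _ ->] ne.
  apply/pred0P => i /=; apply/negP => /andP[/mem_couple[b ->]].
  by move=> /mem_couple[c [gh _]]; rewrite gh eqxx in ne.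
by case: p.
Qed.

(** Knowing a smaller element of each couple is enough: one answer serves all assignments with the
    same choice [f]. *)
Lemma gadget_answer (p : problem) (f : 'I_n -> bool) :
  exists a : answer p (elt n), forall w : elt n -> R, consistent w ->
    (forall g, w (g, Some (f g)) <= w (g, Some (~~ f g))) ->
    correct_answer (gadget p) w a.
Proof.
pose pick S := [pick g | S == couple g].
have pickE g : pick (couple g) = Some g.
  rewrite /pick; case: pickP => [h /eqP|/(_ g)]; last by rewrite eqxx.
  move=> /setP/(_ (g, Some true)); rewrite !inE eqxx orbT => /esym.
  by move=> /orP[]/eqP // [->].
case: p => /=.
- exists (fun S => omap (fun g => (g, Some (f g))) (pick S)).
  move=> w _ fmin _ /imsetP[g _ ->]; exists (g, Some (f g)).
  rewrite pickE; split=> //; first by apply/mem_couple; exists (f g).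
  move=> _ /mem_couple[b ->].
  by have := fmin g; case: (f g) b => [] [].
- exists (fun S => if pick S is Some g then
      [:: (g, Some (f g)); (g, Some (~~ f g))] else [::]).
  move=> w _ fmin _ /imsetP[g _ ->]; rewrite pickE; split=> /=.
    apply: uniq_perm; rewrite ?enum_uniq //=.
      by rewrite inE xpair_eqE eqxx; case: (f g).
    by move=> i; rewrite mem_enum !inE; case: (f g); rewrite // orbC.
  by rewrite fmin.
(* Each triangle contributes its rim edge of weight 0 and its cheaper spoke. *)
- pose T := [set i : elt n | (i.2 == None) || (i.2 == Some (f i.1))].
  exists T => w wI fmin; split.
    by apply/spanning_tree_windmill => g; rewrite !inE /=; case: (f g).
  move=> T' /spanning_tree_windmill T2; rewrite !sum_windmill.
  apply: ler_sum => g _; rewrite !big_option_bool !inE /=.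
  have := T2 g; have := fmin g; have := wI (g, Some true).
  have := wI (g, Some false); have := wI (g, None); rewrite /= => /eqP ->.
  move=> /andP[w1 w2] /andP[w3 w4].
  by case: (f g); do 3!case: (_ \in T') => //=; lra.
Qed.

(** The converse: an answer commits to an order of each couple, with [b] chosen before the
    assignment [w]. *)
Lemma gadget_answer_order (p : problem) (a : answer p (elt n)) (g : 'I_n) :
  exists b, forall w : elt n -> R, consistent w ->
    correct_answer (gadget p) w a -> w (g, Some b) <= w (g, Some (~~ b)).
Proof.
have cF : couple g \in [set couple g | g : 'I_n] by exact: imset_f.
case: p a => /= a.
- exists (a (couple g) == Some (g, Some true)) => w _ /(_ _ cF)[i [-> ig]].
  case/mem_couple: ig => b ->; rewrite (inj_eq Some_inj) xpair_eqE eqxx /=.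
  move=> /(_ (g, Some (~~ b))) wb.
  by case: b wb => /=; apply; apply/mem_couple; [exists false|exists true].
- exists (ohead (a (couple g)) == Some (g, Some true)) => w _ /(_ _ cF)[].
  move=> pa; have := perm_size pa; have := perm_mem pa; have := perm_uniq pa.
  rewrite enum_uniq -cardE cards2 xpair_eqE eqxx /=.
  case: (a _) => [|i [|j [|]]] //=; rewrite inE andbT => ij aE _.
  have : i \in couple g by rewrite -mem_enum -aE inE eqxx.
  have : j \in couple g by rewrite -mem_enum -aE !inE eqxx orbT.
  move=> /mem_couple[b ?] /mem_couple[c ?]; subst; move: ij.
  rewrite (inj_eq Some_inj) !xpair_eqE eqxx /= andbT.
  by case: b c {aE} => [] [].
- exists ((g, Some true) \in a) => w wI mst.
  have := wI (g, Some true); have := wI (g, Some false); have := wI (g, None).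
  rewrite /= => /eqP wN /andP[w1 w2] /andP[w3 w4].
  have swap D := @mst_windmill_swap _ _ _ _ g D mst.
  (* The tree is compared with the rim edge plus either spoke. As spokes have positive weight, it
     uses the rim edge and a cheapest spoke. *)
  have s1 := swap (fun c => c != Some true) erefl.
  have s2 := swap (fun c => c != Some false) erefl.
  have [/spanning_tree_windmill/(_ g) T2 _] := mst.
  move: s1 s2 T2; rewrite !big_option_bool /= wN.
  by do 3!case: (_ \in a) => //=; lra.
Qed.

Lemma related_gadget (p : problem) (g h : 'I_n) (b c : bool) :
  ((h, Some c) \in related (gadget p) (g, Some b)) = (h == g).
Proof.
have cup : ((h, Some c) \in
    \bigcup_(S in [set couple g | g : 'I_n] | (g, Some b) \in S) S) = (h == g).
  apply/bigcupP/eqP => [[S /andP[/imsetP[g' _ ->]]]|->].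
    by move=> /mem_couple[b' [-> _]] /mem_couple[c' [-> _]].
  exists (couple g); last by apply/mem_couple; exists c.
  by rewrite imset_f //; apply/mem_couple; exists b.
case: p => //=; rewrite inE; apply/asboolP/eqP => [[C [cyc]]|->].
  by have [g' ->] := cycle_windmill cyc; rewrite !inE /= => /eqP -> /eqP ->.
exists [set e | e.1 == g]; split; first exact: triangle_cycle.
  by rewrite inE.
by rewrite inE.
Qed.

(** * Feasible and mandatory queries when each value is 6 or decisive *)

(* A value outside the overlap, which decides the order of the couple. *)
Definition far (b : bool) : R := if b then 9 else 3.

Definition polar (v : elt n -> R) : Prop :=
  forall g b, v (g, Some b) = 6 \/ v (g, Some b) = far b.

Definition settled (v : elt n -> R) (Q : {set elt n}) (g : 'I_n) : bool :=
  ((g, Some true) \in Q) && ((g, Some false) \in Q) ||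
  [exists b, ((g, Some b) \in Q) && (v (g, Some b) != 6)].

Lemma far_neq6 (b : bool) : far b != 6.
Proof. by rewrite /far; case: b; rewrite eqr_nat. Qed.

Lemma feasible_gadgetP (p : problem) (pr v : elt n -> R) (Q : {set elt n}) :
  consistent v -> polar v ->
  feasible (Input (gadget p) gadget_ival pr) v Q <-> forall g, settled v Q g.
Proof.
move=> vI vP; split=> [[a aP] g|sQ].
  have [b ab] := gadget_answer_order a g; apply: contraPT ab.
  rewrite negb_or negb_and => /andP[nQ /existsPn v6].
  have {}v6 c : (g, Some c) \in Q -> v (g, Some c) = 6.
    by move=> cQ; have := v6 c; rewrite cQ negbK => /eqP.
  (* In an unsettled couple some element is unqueried and every queried value is 6. Giving unqueried
     elements 7 and 5 makes the element [b] that the answer calls smaller strictly larger. *)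
  pose w i := if i \in Q then v i else if i == (g, Some b) then 7
    else if i == (g, Some (~~ b)) then 5 else v i.
  have wI : consistent w.
    move=> i; rewrite /w; case: ifP => // _.
    case: eqP => [->|_]; last case: eqP => [->|_] //.
      by case: (b); rewrite /= !ltr_nat.
    by case: (b); rewrite /= !ltr_nat.
  have wQ i : i \in Q -> w i = v i by rewrite /w => ->.
  move=> /(_ w wI (aP w wI wQ)); rewrite /w.
  have nb : ((g, Some (~~ b)) == (g, Some b)) = false.
    by rewrite xpair_eqE eqxx; case: (b).
  rewrite nb !eqxx.
  have : ~~ (((g, Some b) \in Q) && ((g, Some (~~ b)) \in Q)).
    by rewrite negb_and; move: nQ; case: (b) => //=; rewrite orbC.
  have := v6 b; have := v6 (~~ b).
  case: (_ \in Q); case: (_ \in Q) => //=.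
  - by move=> _ -> //; rewrite ler_nat.
  - by move=> -> //; rewrite ler_nat.
  - by rewrite ler_nat.
have /choice[f fP] : forall g, exists b, forall w : elt n -> R, consistent w ->
    (forall i, i \in Q -> w i = v i) -> w (g, Some b) <= w (g, Some (~~ b)).
  move=> g; case/orP: (sQ g) => [/andP[tQ fQ]|/existsP[b /andP[bQ]]].
    exists (v (g, Some true) <= v (g, Some false)) => w _ wQ.
    case: (leP (v (g, Some true))) => /= [|/ltW];
      by rewrite (wQ _ tQ) (wQ _ fQ).
  case: (vP g b) => [->|vb _]; first by rewrite eqxx.
  (* A decisive value always makes the [false] element smaller: 3 lies below the interval from 4,
     and 9 above the one up to 8. *)
  exists false => w wI wQ; have := wI (g, Some false); have := wI (g, Some true).
  rewrite /=; move: (wQ _ bQ); rewrite vb /far.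
  by case: b {bQ vb} => /= ->; lra.
have [a aP] := gadget_answer p f.
by exists a => w wI wQ; apply: aP => // g; apply: fP.
Qed.

Lemma card_elt (Q : {set elt n}) :
  #|Q| = (\sum_(g < n) (((g, None) \in Q) + (((g, Some true) \in Q) +
    ((g, Some false) \in Q))))%N.
Proof.
rewrite -sum1_card big_mkcond /=.
transitivity (\sum_(g < n) \sum_c ((g, c) \in Q : nat))%N.
  by rewrite pair_big; apply: eq_bigr => -[g c] _ /=; case: (_ \in Q).
by apply: eq_bigr => g _; rewrite big_option_bool.
Qed.

Lemma settled_count (v : elt n -> R) (Q : {set elt n}) (g : 'I_n) :
  settled v Q g ->
  (0 < ((g, None) \in Q) + (((g, Some true) \in Q) + ((g, Some false) \in Q)))%N.
Proof.
case/orP => [/andP[-> ->]|/existsP[b /andP[]]]; first by rewrite addnS.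
by case: b => ->; case: (_ \in Q); case: (_ \in Q).
Qed.

Lemma settled_card (v : elt n -> R) (Q : {set elt n}) :
  (forall g, settled v Q g) -> (n <= #|Q|)%N.
Proof.
move=> sQ; rewrite card_elt -[leqLHS]card_ord -sum1_card.
by apply: leq_sum => g _; apply: settled_count (sQ g).
Qed.

(** Querying all but one element is infeasible exactly when that element has a partner of value 6,
    since then the partner does not settle the couple. *)
Lemma mandatory_gadget (p : problem) (pr v : elt n -> R) :
  consistent v -> polar v ->
  mandatory (Input (gadget p) gadget_ival pr) v =
  [set i | if i.2 is Some b then v (i.1, Some (~~ b)) == 6 else false].
Proof.
move=> vI vP; apply/setP => i; rewrite !inE; apply/asboolP/idP => [man|].
  have : ~ forall g, settled v (setT :\ i) g.
    by move=> /(feasible_gadgetP p pr _ vI vP) /man; rewrite !inE eqxx.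
  apply: contra_notT; case: i {man} => h [b|] /= vb g; rewrite /settled !inE.
    have [->|gh] := eqVneq g h; last by rewrite !xpair_eqE (negPf gh).
    apply/orP; right; apply/existsP; exists (~~ b).
    by rewrite !inE vb !xpair_eqE eqxx; case: (b).
  by rewrite !xpair_eqE !andbF.
case: i => g [b|] //= /eqP vb Q /(feasible_gadgetP p pr _ vI vP) /(_ g).
case/orP => [/andP[]|/existsP[c /andP[cQ]]]; first by case: b {vb}.
have [<-//|] := eqVneq c b; have [->|] := eqVneq c (~~ b); rewrite ?vb ?eqxx //.
by case: b c {cQ vb} => [] [].
Qed.

(** * Predictions, true values, optimum and error of the instances *)

Variable k : nat.

Definition gadget_pred (i : elt n) : R :=
  if i.2 is Some b then (if (i.1 < k)%N || b then 6 else 3) else 0.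

(** In the first [k] couples [f] selects the decisive element; in the others it is the [false] one,
    as predicted. *)
Definition far_side (f : 'I_n -> bool) (g : 'I_n) : bool := (g < k)%N && f g.

Definition gadget_true (f : 'I_n -> bool) (i : elt n) : R :=
  if i.2 is Some b then (if b == far_side f i.1 then far b else 6) else 0.

Lemma gadget_pred_consistent : consistent gadget_pred.
Proof.
by move=> [g [[]|]] /=; rewrite /gadget_pred /= ?orbT; try case: ifP;
  rewrite ?ltr_nat ?eqxx.
Qed.

Lemma gadget_pred_polar : polar gadget_pred.
Proof.
move=> g b; rewrite /gadget_pred /=; case: ifP => [|/norP[_ /negPf ->]]; auto.
Qed.

Lemma gadget_true_consistent (f : 'I_n -> bool) : consistent (gadget_true f).
Proof.
by move=> [g [[]|]] /=; rewrite /gadget_true /=; try case: ifP;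
  rewrite /far ?ltr_nat ?eqxx.
Qed.

Lemma gadget_true_polar (f : 'I_n -> bool) : polar (gadget_true f).
Proof. by move=> g b; rewrite /gadget_true /=; case: ifP; auto. Qed.

(** Every couple needs a query, and the query of its far element suffices. *)
Lemma gadget_opt (p : problem) (f : 'I_n -> bool) :
  opt (Input (gadget p) gadget_ival gadget_pred) (gadget_true f) = n.
Proof.
have fe := feasible_gadgetP p gadget_pred _ (gadget_true_consistent f)
  (@gadget_true_polar f).
rewrite /opt; case: arg_minnP => [|Q /asboolP/fe sQ minQ].
  by apply/asboolP/fe => g; rewrite /settled !inE.
apply/eqP; rewrite eqn_leq (settled_card sQ) andbT.
pose Q0 : {set elt n} := [set (g, Some (far_side f g)) | g : 'I_n].
rewrite (leq_trans (minQ Q0 _)) //; last first.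
  by rewrite card_imset ?card_ord // => g h [].
apply/asboolP/fe => g; apply/orP; right; apply/existsP; exists (far_side f g).
by rewrite imset_f //= /gadget_true /= eqxx far_neq6.
Qed.

Lemma card_choice (c : 'I_n -> bool) (S : {set elt n}) :
  (k <= n)%N ->
  (forall g d, ((g, d) \in S) = (g < k)%N && (d == Some (c g))) -> #|S| = k.
Proof.
move=> kn SE; rewrite card_elt; under eq_bigr => g _ do rewrite !SE.
transitivity (\sum_(g < n | (g < k)%N) 1)%N.
  rewrite [RHS]big_mkcond; apply: eq_bigr => g _.
  by case: (g < k)%N; case: (c g).
by rewrite -(big_ord_widen n (fun=> 1%N) kn) sum_nat_const card_ord muln1.
Qed.

Lemma gadget_true_pred (f : 'I_n -> bool) (g : 'I_n) (d : option bool) :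
  (gadget_true f (g, d) != gadget_pred (g, d)) =
  (g < k)%N && (d == Some (f g)).
Proof.
rewrite /gadget_true /gadget_pred /far_side /far /=.
case: d => [b|]; last by rewrite eqxx andbF.
by case: (g < k)%N; case: (f g); case: b => /=; rewrite ?eqxx ?eqr_nat.
Qed.

Lemma gadget_error (m : error_measure) (p : problem) (f : 'I_n -> bool) :
  (k <= n)%N ->
  error m (Input (gadget p) gadget_ival gadget_pred) (gadget_true f) = k.
Proof.
move=> kn; case: m => /=.
- by apply: (card_choice (c := f)) => // g d; rewrite inE gadget_true_pred.
- rewrite !mandatory_gadget; try exact: gadget_true_polar;
    try exact: gadget_pred_polar; try exact: gadget_true_consistent;
    try exact: gadget_pred_consistent.
  (* Under the predictions both elements of an early couple are mandatory; in truth only the far one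
     is. The difference is thus its partner. *)
  apply: (card_choice (c := fun g => ~~ f g)) => // g d; rewrite !inE /=.
  case: d => [b|]; last by rewrite !andbF.
  rewrite /gadget_true /gadget_pred /far_side /far /=.
  by case: (g < k)%N; case: (f g); case: b => /=; rewrite ?eqxx ?eqr_nat.
- transitivity #|[set i : elt n | gadget_true f i != gadget_pred i]|; last first.
    by apply: (card_choice (c := f)) => // g d; rewrite inE gadget_true_pred.
  rewrite -sum1_card [RHS]big_mkcond; apply: eq_bigr => -[g d] _.
  rewrite inE; case: eqP => /= [->|/eqP].
    rewrite big1 // => j _; rewrite /hops; case: gadget_ival => [l u|c].
      by rewrite le_lt_asym lt_le_asym.
    by rewrite !lt_asym.
  rewrite gadget_true_pred => /andP[gk /eqP ->].
  have -> : gadget_true f (g, Some (f g)) = far (f g).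
    by rewrite /gadget_true /far_side /= gk eqxx.
  have -> : gadget_pred (g, Some (f g)) = 6 by rewrite /gadget_pred /= gk.
  (* Moving from 6 to 9 or to 3 passes one endpoint, 8 or 4, of the partner's interval, and stays
     inside the element's own interval. *)
  rewrite (bigD1 (g, Some (~~ f g))) ?related_gadget //= big1 => [|[h [b|]]].
  - by rewrite /far; case: (f g); rewrite /= !(ltr_nat, ler_nat).
  - rewrite related_gadget xpair_eqE => /andP[/eqP ->]; rewrite eqxx /= => nb.
    by move: nb; rewrite /far; case: (f g); case: b; rewrite //= !(ltr_nat, ler_nat).
  - move=> _; rewrite /far; case: (f g); by rewrite /= !ltrn0 ?andbF.
Qed.

End Gadget.

(** * The adversary against a deterministic algorithm *)

Section Adversary.
Variables (R : realType) (p : problem) (A : algorithm R p).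

(** A deterministic run depends on the true values only through those it has revealed. *)
Lemma eq_history (E : finType) (x : input R p E) (w w' : E -> R) (t : nat) :
  {in unzip1 (history A x w t), w =1 w'} ->
  history A x w' t = history A x w t.
Proof.
elim: t => [//|t IH] /=; case hA: (A x (history A x w t)) => [i|] eqw.
  rewrite IH ?hA => [|j jh].
    by rewrite eqw // /unzip1 map_rcons mem_rcons inE eqxx.
  by apply: eqw; rewrite /unzip1 map_rcons mem_rcons inE jh orbT.
by rewrite IH ?hA.
Qed.

Lemma history_halted (E : finType) (x : input R p E) (w : E -> R) (s t : nat) :
  (s <= t)%N -> A x (history A x w s) = None ->
  history A x w t = history A x w s.
Proof.
move=> /subnKC <- halt; elim: (t - s)%N => [|d IH]; first by rewrite addn0.
by rewrite addnS /= IH halt.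
Qed.

Variables n k : nat.

Let x : input R p (elt n) :=
  Input (gadget n p) (@gadget_ival R n) (@gadget_pred R n k).
Let queries (f : 'I_n -> bool) (t : nat) : seq (elt n) :=
  unzip1 (history A x (gadget_true R k f) t).

(* If step [t] asks for the far element of a couple that is still untouched, *)
(* exchange the roles of its two elements: the history so far is unaffected. *)
Lemma far_queried_last (t : nat) : exists f : {ffun 'I_n -> bool},
  forall g : 'I_n, (g < k)%N ->
    (g, Some (f g)) \in queries f t -> (g, Some (~~ f g)) \in queries f t.
Proof.
elim: t => [|t [f fP]]; first by exists [ffun=> true].
have stepE f' : queries f' t.+1 =
    if A x (history A x (gadget_true R k f') t) is Some i
    then rcons (queries f' t) i else queries f' t.
  by rewrite /queries /=; case: (A x _) => // i; rewrite /unzip1 map_rcons.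
case hA: (A x (history A x (gadget_true R k f) t)) => [i|]; last first.
  by exists f; rewrite stepE hA.
have [/existsP[g /and3P[gk /eqP ei gN]]|/existsPn bad] := boolP [exists g : 'I_n,
    [&& (g < k)%N, i == (g, Some (f g)) & (g, Some (~~ f g)) \notin queries f t]].
  have gN' : (g, Some (f g)) \notin queries f t by apply: contra gN; apply: fP.
  pose f' := [ffun h => if h == g then ~~ f h else f h].
  have eqh : history A x (gadget_true R k f') t = history A x (gadget_true R k f) t.
    apply: eq_history => -[h d] hq; rewrite /gadget_true /far_side /= ffunE.
    case: d hq => [b|//]; rewrite -/(queries f t).
    have [->|//] := eqVneq h g => bq.
    by move: gN gN'; case: (f g); case: b bq => ->.
  exists f' => h hk; rewrite stepE eqh hA /queries eqh -/(queries f t).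
  rewrite !mem_rcons !inE ei !xpair_eqE /= !ffunE.
  case: eqP => [->|_] /=; last by move=> /(fP _ hk) ->.
  by rewrite (negPf gN) orbF; case: (f g).
exists f => g gk; rewrite stepE hA !mem_rcons !inE.
case/orP => [/eqP ei|/(fP _ gk) ->]; last by rewrite orbT.
by have := bad g; rewrite gk ei eqxx /= negbK => ->; rewrite orbT.
Qed.

End Adversary.

(** * From the queried couples to the competitive ratio *)

Theorem theorem4 (R : realType) (m : error_measure) (p : problem)
    (A : algorithm R p) (hA : algorithm_for_disjoint A)
    (k o : nat) (ho : (0 < o)%N) :
  exists (E : finType) (x : input R p E) (w : E -> R) (t : nat),
    [/\ valid_instance x w /\ disjoint_sets (struct x),
        opt x w = o,
        error m x w = minn k o,
        solves_with A x w t &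
        Num.min (1 + k%:R / o%:R) 2 * o%:R <= t%:R :> R].
Proof.
pose k' := minn k o.
pose x : input R p (elt o) :=
  Input (gadget o p) (@gadget_ival R o) (@gadget_pred R o k').
have valid f : valid_instance x (gadget_true R k' f).
  split; first exact: gadget_valid; first exact: gadget_true_consistent.
  exact: gadget_pred_consistent.
have /choice[T TP] : forall f : {ffun 'I_o -> bool}, exists t,
    solves_with A x (gadget_true R k' f) t.
  by move=> f; apply: hA => //; apply: gadget_disjoint.
(* The assignment depends on the number of steps and the halting time on the assignment. The maximum
   over the finitely many [f] breaks this circle, as a halted run stays unchanged. *)
have [f fP] := @far_queried_last R p A o k' (\max_f T f).
have solf := TP f; have [halt sz feas] := solf.
rewrite (history_halted _ halt) ?leq_bigmax // in fP.
exists (elt o), x, (gadget_true R k' f), (T f); split=> //.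
- by split=> //; apply: gadget_disjoint.
- exact: gadget_opt.
- by apply: gadget_error; apply: geq_minr.
set Q := [set i in _] in feas.
have sQ := (feasible_gadgetP p _ Q (@gadget_true_consistent R o k' f)
  (@gadget_true_polar R o k' f)).1 feas.
(* A queried value other than 6 belongs to the far element, and by [fP] its partner was queried
   too. *)
have both (g : 'I_o) : (g < k')%N ->
    ((g, Some true) \in Q) && ((g, Some false) \in Q).
  move=> gk; case/orP: (sQ g) => [//|/existsP[b]].
  case/andP => bQ; rewrite /gadget_true /far_side gk /=.
  have [eb _|] := eqVneq b (f g); last by rewrite eqxx.
  rewrite eb inE in bQ; have := fP _ gk bQ; move: bQ; rewrite !inE.
  by case: (f g) => -> ->.
have leT : (o + k' <= T f)%N.
  have -> : (o + k' = \sum_(g < o) (1 + (g < k')))%N.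
    rewrite big_split /= sum1_card card_ord; congr addn.
    rewrite -big_mkcond /= -(big_ord_widen o (fun=> 1%N) (geq_minr k o)).
    by rewrite sum1_card card_ord.
  rewrite -sz -(size_map fst) (leq_trans _ (card_size _)) //.
  rewrite (_ : #|_| = #|Q|); last by apply: eq_card => i; rewrite inE.
  rewrite card_elt; apply: leq_sum => g _.
  have [/both/andP[-> ->]|_] := boolP (g < k')%N; first by rewrite leq_addl.
  exact: settled_count (sQ g).
have o0 : 0 < o%:R :> R by rewrite ltr0n.
(* The bound [min (1 + k / o, 2) * o] equals [o + min (k, o)]. *)
apply: (@le_trans _ _ (o + k')%:R); last by rewrite ler_nat.
rewrite -ler_pdivlMr // ge_min natrD mulrDl divff ?gt_eqF //.
rewrite /k'; case: (leqP k o) => ko; first by rewrite lexx.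
by rewrite divff ?gt_eqF // -(natrD _ 1 1) lexx orbT.
Qed.
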